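(* Let $c,\kappa_0>0$ and consider the fourth-order active flux semi-discretization (written in the context) of $u_t+cu_x=\kappa_0u_{xx}$ on $[0,2\pi]$ with initial data $u(x,0)=\hat u_0e^{\mathrm i\omega x}$, on a uniform mesh of size $\Delta x$ with periodic boundary conditions. Let $\lambda=-\mathrm i c\omega-\kappa_0\omega^2$ and $$\hat{\boldsymbol u}_0=\hat u_0\Bigl(\tfrac2\xi\sin\tfrac\xi2,\;e^{\mathrm i\xi/2}\Bigr)^\top,\qquad \xi=\omega\Delta x.$$ In the cell $I_j$ with center $x_j$, let $\boldsymbol u(t)=\hat{\boldsymbol u}_0e^{\lambda t+\mathrm i\omega x_j}$ be the exact solution (its cell average and its right-interface point value) and let $\boldsymbol u_h(t)=\hat{\boldsymbol u}(t)e^{\mathrm i\omega x_j}$ be the numerical solution, where $\frac{\mathrm d}{\mathrm dt}\hat{\boldsymbol u}=\boldsymbol G\hat{\boldsymbol u}$, $\hat{\boldsymbol u}(0)=\hat{\boldsymbol u}_0$, and $\boldsymbol G$ is the semi-discrete Fourier matrix given in the context. Then for $t>0$ $$\|\boldsymbol e(t)\|_{L^2}=\|\boldsymbol u(t)-\boldsymbol u_h(t)\|_{L^2}\le C_1t\,\Delta x^4+C_2\,\Delta x^4,$$ where $C_1,C_2$ are positive constants independent of $\Delta x$ (and of $t$). Thus the active flux method is fourth-order accurate in space.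
   Context: $\mathrm i=\sqrt{-1}$. Cells $I_j=[x_{j-\frac12},x_{j+\frac12}]$ are uniform of size $\Delta x$ with centers $x_j$; the wavenumber satisfies $\xi=\omega\Delta x\in[-\pi,\pi]$. The unknowns are cell averages $\bar u_j(t)$ and interface point values $u_{j+\frac12}(t)$, with cell-centered values $u_j=\frac14(6\bar u_j-u_{j-\frac12}-u_{j+\frac12})$. The active flux method is $$\frac{\mathrm d\bar u_j}{\mathrm dt}=-\frac{c}{\Delta x}(u_{j+\frac12}-u_{j-\frac12})+\frac{\kappa_0}{2\Delta x^2}\bigl(-u_{j-\frac32}+4\bar u_{j-1}+u_{j-\frac12}-8\bar u_j+u_{j+\frac12}+4\bar u_{j+1}-u_{j+\frac32}\bigr),$$ $$\frac{\mathrm du_{j+\frac12}}{\mathrm dt}=-\frac{c}{3\Delta x}\bigl(u_{j-\frac12}-6u_j+3u_{j+\frac12}+2u_{j+1}\bigr)+\frac{\kappa_0}{3\Delta x^2}\bigl(-5u_{j-\frac12}+24\bar u_j-38u_{j+\frac12}+24\bar u_{j+1}-5u_{j+\frac32}\bigr).$$ The ansatz $[\bar u_j(t),u_{j+\frac12}(t)]^\top=\hat{\boldsymbol u}(t)e^{\mathrm i\omega x_j}$ gives $\frac{\mathrm d}{\mathrm dt}\hat{\boldsymbol u}=\boldsymbol G\hat{\boldsymbol u}$ with, for $t_x=e^{\mathrm i\xi}$, $$\boldsymbol G=\frac{c}{\Delta x}\begin{bmatrix}0&t_x^{-1}-1\\3-t_x&\frac16(-5t_x^{-1}-8+t_x)\end{bmatrix}+\frac{\kappa_0}{\Delta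 x^2}\begin{bmatrix}2(t_x^{-1}-2+t_x)&\frac12(-t_x^{-2}+t_x^{-1}+1-t_x)\\8(1+t_x)&-\frac13(5t_x^{-1}+38+5t_x)\end{bmatrix}.$$ The vector $\hat{\boldsymbol u}_0$ equals $e^{-\mathrm i\omega x_j}\bigl(\frac1{\Delta x}\int_{I_j}u(x,0)\,\mathrm dx,\;u(x_{j+\frac12},0)\bigr)^\top$; for $\xi=0$ the expression $\frac2\xi\sin\frac\xi2$ is read as $1$. The exact solution is $u(x,t)=\hat u_0e^{\lambda t+\mathrm i\omega x}$. The norm $\|\cdot\|_{L^2}$ of a two-component vector is the Euclidean norm on $\mathbb C^2$. The constants may depend on $c,\kappa_0,\omega,\hat u_0$, which are fixed. *)

(* Defs.v *)
From Stdlib Require Import Reals ZArith Lra Lia.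
From Coquelicot Require Import Coquelicot.
Open Scope R_scope.

Definition Cexp (z : C) : C := (exp (Re z) * cos (Im z), exp (Re z) * sin (Im z)).

(** [C^2] as a real normed module; its product norm is the Euclidean one. *)
Definition CC : NormedModule R_AbsRing :=
  prod_NormedModule R_AbsRing C_R_NormedModule C_R_NormedModule.

Definition norm2 (v : CC) : R := sqrt (Cmod (fst v) ^ 2 + Cmod (snd v) ^ 2).

Definition cscal (z : C) (v : CC) : CC := (z * fst v, z * snd v)%C.

Definition mat2 (a b c d : C) : matrix 2 2 :=
  mk_matrix 2 2 (fun i j => match i, j with
    | O, O => a | O, _ => b | _, O => c | _, _ => d end).

Definition mulmv (A : matrix 2 2) (v : CC) : CC :=
  let a i j := coeff_mat (RtoC 0) A i j in
  (a 0%nat 0%nat * fst v + a 0%nat 1%nat * snd v,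
   a 1%nat 0%nat * fst v + a 1%nat 1%nat * snd v)%C.

(** [v' = A v] on [(0, +oo)] with [v] right-continuous at [0], [v 0 = v0]. *)
Definition solves_ivp (A : matrix 2 2) (v0 : CC) (v : R -> CC) : Prop :=
  v 0 = v0 /\
  filterlim v (at_right 0) (locally (v 0)) /\
  (forall t, 0 < t -> is_derive v t (mulmv A (v t))).

(** Uniform mesh of [0, 2 PI] with [N] cells; cell [j] is
    [[j * mesh_size N, (j + 1) * mesh_size N]], for [0 <= j < N]. *)
Definition mesh_size (N : nat) : R := 2 * PI / INR N.
Definition center (dx : R) (j : Z) : R := (IZR j + / 2) * dx.

Definition wave (w x : R) : C := Cexp (Ci * (w * x)%R).

(** For a grid function, [ub j] is the average over cell [j] and [up j] is the point
    value at its right interface [x_{j+1/2}]; hence [up (j - 1)] is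
    [u_{j-1/2}]. *)
Section Scheme.
Variables (c kappa0 dx : R) (ub up : Z -> C).

Definition cell_value (j : Z) : C := (/ 4 * (6 * ub j - up (j - 1)%Z - up j))%C.

Definition af_avg (j : Z) : C :=
  (- (c / dx)%R * (up j - up (j - 1)%Z)
   + (kappa0 / (2 * dx ^ 2))%R *
     (- up (j - 2)%Z + 4 * ub (j - 1)%Z + up (j - 1)%Z - 8 * ub j
      + up j + 4 * ub (j + 1)%Z - up (j + 1)%Z))%C.

Definition af_point (j : Z) : C :=
  (- (c / (3 * dx))%R *
     (up (j - 1)%Z - 6 * cell_value j + 3 * up j + 2 * cell_value (j + 1)%Z)
   + (kappa0 / (3 * dx ^ 2))%R *
     (- (5) * up (j - 1)%Z + 24 * ub j - 38 * up j
      + 24 * ub (j + 1)%Z - 5 * up (j + 1)%Z))%C.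
End Scheme.

Definition af_solution (c kappa0 : R) (N : nat) (ub up : R -> Z -> C) : Prop :=
  let dx := mesh_size N in
  (forall t j, ub t (j + Z.of_nat N)%Z = ub t j /\ up t (j + Z.of_nat N)%Z = up t j) /\
  forall t j, 0 < t ->
    is_derive (V := C_R_NormedModule) (fun s => ub s j) t
      (af_avg c kappa0 dx (ub t) (up t) j) /\
    is_derive (V := C_R_NormedModule) (fun s => up s j) t
      (af_point c kappa0 dx (ub t) (up t) j).

Definition G_adv (xi : R) : matrix 2 2 :=
  let tx := wave xi 1 in
  mat2 0 (/ tx - 1)
       (3 - tx) (/ 6 * (- (5) * / tx - 8 + tx))%C.

Definition G_diff (xi : R) : matrix 2 2 :=
  let tx := wave xi 1 in
  mat2 (2 * (/ tx - 2 + tx)) (/ 2 * (- / (tx ^ 2) + / tx + 1 - tx))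
       (8 * (1 + tx)) (- (/ 3) * (5 * / tx + 38 + 5 * tx))%C.

Definition fourier_matrix (c kappa0 dx xi : R) : matrix 2 2 :=
  mk_matrix 2 2 (fun i j =>
    (c / dx)%R * coeff_mat (RtoC 0) (G_adv xi) i j
    + (kappa0 / dx ^ 2)%R * coeff_mat (RtoC 0) (G_diff xi) i j)%C.

(** [2 / xi * sin (xi / 2)], extended by its limit [1] at [0]. *)
Definition sinc_half (xi : R) : R :=
  if Req_EM_T xi 0 then 1 else 2 / xi * sin (xi / 2).

Definition uhat_init (u0 : C) (xi : R) : CC :=
  (u0 * sinc_half xi, u0 * wave xi (/ 2))%C.

Definition lambda (c kappa0 w : R) : C :=
  (- (Ci * (c * w)%R) - (kappa0 * w ^ 2)%R)%C.

Definition exact_vec (c kappa0 w dx : R) (u0 : C) (j : Z) (t : R) : CC :=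
  cscal (Cexp (lambda c kappa0 w * t + Ci * (w * center dx j)%R)) (uhat_init u0 (w * dx)).

Definition numerical_vec (w dx : R) (uhat : R -> CC) (j : Z) (t : R) : CC :=
  cscal (wave w (center dx j)) (uhat t).

(** [af_solution_of_ivp]: the plane wave whose amplitude solves [v' = G v]
    is a periodic solution of the scheme. [exact_vecE]: the components of
    [exact_vec] are the cell average (multiplied by [dx]) and the right
    interface value of the exact solution. *)

Definition pde_solution (c kappa0 w : R) (u0 : C) (x t : R) : C :=
  (u0 * Cexp (lambda c kappa0 w * t + Ci * (w * x)%R))%C.

Lemma Cexp_add (a b : C) : Cexp (a + b) = (Cexp a * Cexp b)%C.
Proof.
destruct a as [a1 a2], b as [b1 b2]; unfold Cexp, Cmult, Cplus, Re, Im; simpl.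
rewrite exp_plus, cos_plus, sin_plus; f_equal; ring.
Qed.

Lemma waveE (w x : R) : wave w x = (cos (w * x), sin (w * x)).
Proof.
unfold wave, Cexp, Re, Im; simpl.
replace (0 * (w * x) - 1 * 0) with 0 by ring.
replace (0 * 0 + 1 * (w * x)) with (w * x) by ring.
now rewrite exp_0, !Rmult_1_l.
Qed.

Lemma wave_add (w x y : R) : wave w (x + y) = (wave w x * wave w y)%C.
Proof.
rewrite !waveE; unfold Cmult; simpl.
rewrite Rmult_plus_distr_l, cos_plus, sin_plus; f_equal; ring.
Qed.

Lemma wave_neq0 (w x : R) : wave w x <> RtoC 0.
Proof.
rewrite waveE; intros H; injection H; intros H1 H2.
generalize (sin2_cos2 (w * x)); unfold Rsqr; rewrite H1, H2; lra.
Qed.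

Lemma wave_next (w dx : R) (j : Z) :
  wave w (center dx (j + 1)) = (wave (w * dx) 1 * wave w (center dx j))%C.
Proof.
replace (center dx (j + 1)) with (dx + center dx j)
  by (unfold center; rewrite plus_IZR; ring).
rewrite wave_add; f_equal; rewrite !waveE; now rewrite Rmult_1_r.
Qed.

Lemma wave_prev (w dx : R) (j : Z) :
  wave w (center dx (j - 1)) = (/ wave (w * dx) 1 * wave w (center dx j))%C.
Proof.
generalize (wave_next w dx (j - 1)); replace (j - 1 + 1)%Z with j by ring.
intros ->; field; apply wave_neq0.
Qed.

Section PlaneWave.
Variables (c kappa0 dx w : R) (v : CC).
Hypothesis dx_neq0 : dx <> 0.
Let ub j := (fst v * wave w (center dx j))%C.
Let up j := (snd v * wave w (center dx j))%C.
Let G := fourier_matrix c kappa0 dx (w * dx).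

Let Hdx : RtoC dx <> RtoC 0.
Proof. intros H; apply dx_neq0; now apply RtoC_inj. Qed.

Let HR (n : R) : n <> 0 -> RtoC n <> RtoC 0.
Proof. intros Hn H; apply Hn; now apply RtoC_inj. Qed.

Let Hmul (n : R) : n <> 0 -> n * dx <> 0 /\ n * dx ^ 2 <> 0.
Proof.
intros Hn; split; apply Rmult_integral_contrapositive; split; auto.
now apply pow_nonzero.
Qed.

Let H2 : 2 <> 0. Proof. lra. Qed.
Let H3 : 3 <> 0. Proof. lra. Qed.
Let H4 : 4 <> 0. Proof. lra. Qed.
Let H6 : 6 <> 0. Proof. lra. Qed.

Lemma af_wave (j : Z) :
  af_avg c kappa0 dx ub up j = (fst (mulmv G v) * wave w (center dx j))%C /\
  af_point c kappa0 dx ub up j = (snd (mulmv G v) * wave w (center dx j))%C.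
Proof.
destruct (Hmul 2 H2) as [_ D2], (Hmul 3 H3) as [D3 D3'].
assert (Dx2 : dx ^ 2 <> 0) by now apply pow_nonzero.
unfold af_avg, af_point, cell_value, ub, up, G.
replace (j - 2)%Z with (j - 1 - 1)%Z by ring.
replace (j + 1 - 1)%Z with j by ring.
rewrite !wave_next, !wave_prev.
unfold mulmv, fourier_matrix, G_adv, G_diff, mat2, coeff_mat, mk_matrix.
cbn -[pow].
rewrite !RtoC_div, !RtoC_mult, !RtoC_pow, ?RtoC_inv by auto.
generalize (wave_neq0 (w * dx) 1); intros Ht.
generalize (wave (w * dx) 1) (wave w (center dx j)) Ht; intros t z Ht'.
split; field; repeat split; auto.
Qed.
End PlaneWave.

Lemma wave_period (N : nat) (k j : Z) : (0 < N)%nat ->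
  let dx := mesh_size N in
  wave (IZR k) (center dx (j + Z.of_nat N)) = wave (IZR k) (center dx j).
Proof.
intros HN dx.
assert (HN' : INR N <> 0) by (apply not_0_INR; lia).
rewrite !waveE.
replace (IZR k * center dx (j + Z.of_nat N))
  with (IZR k * center dx j + IZR k * (2 * PI))
  by (unfold dx, mesh_size, center; rewrite plus_IZR, <- INR_IZR_INZ; field; auto).
assert (Hs : sin (IZR k * (2 * PI)) = 0)
  by (apply sin_eq_0_1; exists (2 * k)%Z; rewrite mult_IZR; ring).
assert (Hc : cos (IZR k * (2 * PI)) = 1).
{ replace (IZR k * (2 * PI)) with (2 * (IZR k * PI)) by ring.
  rewrite cos_2a_sin, (sin_eq_0_1 (IZR k * PI)) by now exists k.
  ring. }
rewrite cos_plus, sin_plus, Hs, Hc; f_equal; ring.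
Qed.

Lemma norm_CR (z : C_R_NormedModule) : norm z = Cmod z.
Proof.
change (norm z) with (sqrt (Rabs (fst z) ^ 2 + Rabs (snd z) ^ 2)).
now rewrite !pow2_abs.
Qed.

Lemma is_linear_Cmult_r (z : C) :
  is_linear (U := C_R_NormedModule) (V := C_R_NormedModule) (fun u => (u * z)%C).
Proof.
split.
- intros x y; apply Cmult_plus_distr_r.
- intros k x; rewrite !scal_R_Cmult; symmetry; apply Cmult_assoc.
- exists (Cmod z + 1); split.
  + generalize (Cmod_ge_0 z); lra.
  + intros x; rewrite !norm_CR, Cmod_mult.
    generalize (Cmod_ge_0 x); nra.
Qed.

Lemma is_derive_comp_linear (U V W : NormedModule R_AbsRing)
    (f : R -> U) (L : U -> V) (t : R) (l : U) :
  is_linear L -> is_derive f t l -> is_derive (fun s => L (f s)) t (L l).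
Proof.
intros HL Hf; eapply filterdiff_ext_lin.
- apply (filterdiff_comp' f L); [exact Hf | now apply filterdiff_linear].
- intros y; simpl; apply linear_scal, HL.
Qed.

Lemma af_solution_of_ivp (c kappa0 : R) (omega : Z) (N : nat) (v0 : CC) (uhat : R -> CC) :
  (0 < N)%nat ->
  let dx := mesh_size N in
  let w := IZR omega in
  solves_ivp (fourier_matrix c kappa0 dx (w * dx)) v0 uhat ->
  af_solution c kappa0 N (fun t j => fst (numerical_vec w dx uhat j t))
                         (fun t j => snd (numerical_vec w dx uhat j t)).
Proof.
intros HN dx w [_ [_ Hd]].
assert (Hdx : dx <> 0).
{ apply Rmult_integral_contrapositive; split.
  - generalize PI_RGT_0; lra.
  - apply Rinv_neq_0_compat, not_0_INR; lia. }
split.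
- intros t j; unfold numerical_vec, w, dx; now rewrite wave_period.
- intros t j Ht; specialize (Hd t Ht); unfold numerical_vec, cscal; simpl fst; simpl snd.
  fold dx.
  destruct (af_wave c kappa0 dx w (uhat t) Hdx j) as [E1 E2].
  split.
  + eapply is_derive_ext; [intros s; apply Cmult_comm |].
    replace (af_avg _ _ _ _ _ _) with (fst (mulmv (fourier_matrix c kappa0 dx (w * dx)) (uhat t)) * wave w (center dx j))%C.
    * apply (is_derive_comp_linear CC C_R_NormedModule C_R_NormedModule uhat
        (fun u => (fst u * wave w (center dx j))%C)); auto.
      apply (is_linear_comp (U := CC) (V := C_R_NormedModule) (W := C_R_NormedModule) fst
        (fun u => (u * wave w (center dx j))%C)).
      apply is_linear_fst. apply is_linear_Cmult_r.
    * rewrite <- E1; unfold af_avg; now rewrite !(Cmult_comm (wave _ _)).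
  + eapply is_derive_ext; [intros s; apply Cmult_comm |].
    replace (af_point _ _ _ _ _ _) with (snd (mulmv (fourier_matrix c kappa0 dx (w * dx)) (uhat t)) * wave w (center dx j))%C.
    * apply (is_derive_comp_linear CC C_R_NormedModule C_R_NormedModule uhat
        (fun u => (snd u * wave w (center dx j))%C)); auto.
      apply (is_linear_comp (U := CC) (V := C_R_NormedModule) (W := C_R_NormedModule) snd
        (fun u => (u * wave w (center dx j))%C)).
      apply is_linear_snd. apply is_linear_Cmult_r.
    * rewrite <- E2; unfold af_point, cell_value; now rewrite !(Cmult_comm (wave _ _)).
Qed.

Lemma is_RInt_wave (w dx : R) (j : Z) : dx <> 0 ->
  is_RInt (V := C_R_NormedModule) (wave w) (center dx j - dx / 2) (center dx j + dx / 2)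
    (dx * (sinc_half (w * dx) * wave w (center dx j)))%C.
Proof.
intros Hdx; set (x := center dx j).
assert (P : forall f g lf lg a b, is_RInt f a b lf -> is_RInt g a b lg ->
  is_RInt (V := C_R_NormedModule) (fun y => (f y, g y)) a b (lf, lg)).
{ intros; now apply is_RInt_fct_extend_pair. }
eapply is_RInt_ext; [intros y _; symmetry; apply waveE |].
rewrite waveE; unfold sinc_half, Cmult; simpl.
destruct (Req_EM_T (w * dx) 0) as [E | E].
- assert (w = 0) by (apply Rmult_integral in E; tauto); subst w.
  replace (_, _) with (dx, 0)
    by (rewrite !Rmult_0_l, cos_0, sin_0; f_equal; ring).
  apply P.
  + apply is_RInt_ext with (fun _ => 1); [intros; now rewrite Rmult_0_l, cos_0 |].
    replace dx with (scal (x + dx / 2 - (x - dx / 2)) 1) at 3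
      by (unfold scal; simpl; unfold mult; simpl; field).
    apply (is_RInt_const (V := R_NormedModule)).
  + apply is_RInt_ext with (fun _ => 0); [intros; now rewrite Rmult_0_l, sin_0 |].
    replace 0 with (scal (x + dx / 2 - (x - dx / 2)) 0) at 1
      by (unfold scal; simpl; unfold mult; simpl; ring).
    apply (is_RInt_const (V := R_NormedModule)).
- assert (Hw : w <> 0) by (intros ->; apply E; ring).
  replace (_, _) with
    (sin (w * (x + dx / 2)) / w - sin (w * (x - dx / 2)) / w,
     - cos (w * (x + dx / 2)) / w - - cos (w * (x - dx / 2)) / w).
  + apply P.
    * apply (is_RInt_derive (V := R_CompleteNormedModule) (fun y => sin (w * y) / w)).
      -- intros y _; auto_derive; auto; field; auto.
      -- intros y _; apply (ex_derive_continuous (V := R_NormedModule)); auto_derive; auto.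
    * apply (is_RInt_derive (V := R_CompleteNormedModule) (fun y => - cos (w * y) / w)).
      -- intros y _; auto_derive; auto; field; auto.
      -- intros y _; apply (ex_derive_continuous (V := R_NormedModule)); auto_derive; auto.
  + replace (w * (x + dx / 2)) with (w * x + w * dx / 2) by field.
    replace (w * (x - dx / 2)) with (w * x - w * dx / 2) by field.
    rewrite sin_plus, sin_minus, cos_plus, cos_minus.
    f_equal; field; auto.
Qed.

Lemma exact_vecE (c kappa0 w dx : R) (u0 : C) (j : Z) (t : R) : dx <> 0 ->
  is_RInt (V := C_R_NormedModule) (fun x => pde_solution c kappa0 w u0 x t)
    (center dx j - dx / 2) (center dx j + dx / 2)
    (dx * fst (exact_vec c kappa0 w dx u0 j t))%C /\
  snd (exact_vec c kappa0 w dx u0 j t)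
    = pde_solution c kappa0 w u0 (center dx j + dx / 2) t.
Proof.
intros Hdx; unfold pde_solution, exact_vec, cscal, uhat_init; simpl fst; simpl snd.
fold (wave w (center dx j)).
set (e := Cexp (lambda c kappa0 w * t)).
split.
- replace (dx * _)%C with
    (dx * (sinc_half (w * dx) * wave w (center dx j)) * (u0 * e))%C
    by (rewrite Cexp_add; fold e; unfold wave; ring).
  apply is_RInt_ext with (fun x => (wave w x * (u0 * e))%C).
  + intros x _; rewrite Cexp_add; fold e; unfold wave.
    match goal with |- ?l = ?r => change (@eq C l r) end; ring.
  + assert (H := is_RInt_wave w dx j Hdx).
    set (a := center dx j - dx / 2) in *; set (b := center dx j + dx / 2) in *.
    set (L := (dx * (sinc_half (w * dx) * wave w (center dx j)))%C) in *.
    generalize (is_RInt_fct_extend_fst _ _ _ _ H) (is_RInt_fct_extend_snd _ _ _ _ H).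
    intros Hf Hs.
    destruct (u0 * e)%C as [p q].
    apply (is_RInt_fct_extend_pair (U := R_NormedModule) (V := R_NormedModule)).
    * change (is_RInt (fun x => fst (wave w x) * p - snd (wave w x) * q) a b
        (fst L * p - snd L * q)).
      apply (is_RInt_minus (V := R_NormedModule)).
      -- apply is_RInt_ext with (fun x => scal p (fst (wave w x))); [intros; apply Rmult_comm |].
         rewrite (Rmult_comm _ p); now apply (is_RInt_scal (V := R_NormedModule)).
      -- apply is_RInt_ext with (fun x => scal q (snd (wave w x))); [intros; apply Rmult_comm |].
         rewrite (Rmult_comm _ q); now apply (is_RInt_scal (V := R_NormedModule)).
    * change (is_RInt (fun x => fst (wave w x) * q + snd (wave w x) * p) a b
        (fst L * q + snd L * p)).
      apply (is_RInt_plus (V := R_NormedModule)).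
      -- apply is_RInt_ext with (fun x => scal q (fst (wave w x))); [intros; apply Rmult_comm |].
         rewrite (Rmult_comm _ q); now apply (is_RInt_scal (V := R_NormedModule)).
      -- apply is_RInt_ext with (fun x => scal p (snd (wave w x))); [intros; apply Rmult_comm |].
         rewrite (Rmult_comm _ p); now apply (is_RInt_scal (V := R_NormedModule)).
- rewrite !Cexp_add; fold e.
  change (Cexp (Ci * (w * (center dx j + dx / 2))%R)) with (wave w (center dx j + dx / 2)).
  change (Cexp (Ci * (w * center dx j)%R)) with (wave w (center dx j)).
  rewrite wave_add.
  replace (wave (w * dx) (/ 2)) with (wave w (dx / 2))
    by (rewrite !waveE; replace (w * dx * / 2) with (w * (dx / 2)) by field; reflexivity).
  match goal with |- ?l = ?r => change (@eq C l r) end; ring.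
Qed.

(* Main.v *)
Require Import Defs.
From Stdlib Require Import Reals ZArith Lra Lia Psatz.
From Coquelicot Require Import Coquelicot.
Open Scope R_scope.

(** The error [e = (e1, e2)] satisfies [e' = G e + e^(lambda t) r] with the residual
    [r = (lambda - G) uhat_0], where [r1 = O(dx^4)] and [r2 = O(dx^2)]. Let [l1], [l2] be
    the eigenvalues of [G] with [Re l2 <= Re l1]. By the Routh-Hurwitz criterion
    [Re l1 <= 0], and since [Re (tr G) <= - 16 kappa0 / dx^2], also
    [Re l2 <= - 8 kappa0 / dx^2]. If [(1, p)] is an eigenvector for [l1], then
    [y = e2 - p e1] satisfies [y' = l2 y + O(dx^2)], whose damping yields [y = O(dx^4)]
    uniformly in time. As [G12 = O(1)], the equation
    [e1' = l1 e1 + G12 y + e^(lambda t) r1] gives [e1 = O(t dx^4)]. *)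

(** * Complex quadratics and Duhamel bounds *)

(** Half-angle formulas: with [m] the modulus of [z], the root has real part [sqrt ((m + x) / 2)]
    and imaginary part [sqrt ((m - x) / 2)] up to sign. The product of the two square roots is
    [Rabs y / 2], so the sign of [y] decides which sign to take. *)
Lemma Csqrt_exists (z : C) : exists s : C, (s * s)%C = z.
Proof.
destruct z as [x y].
assert (Hm : x ^ 2 <= x ^ 2 + y ^ 2) by nra.
set (m := sqrt (x ^ 2 + y ^ 2)).
assert (Hmx : Rabs x <= m).
{ unfold m; rewrite <- (sqrt_pow2 (Rabs x)) by apply Rabs_pos.
  rewrite pow2_abs; now apply sqrt_le_1_alt. }
assert (Hm2 : m * m = x ^ 2 + y ^ 2) by (apply sqrt_sqrt; nra).
assert (H1 : 0 <= (m + x) / 2) by (apply Rabs_le_between in Hmx; lra).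
assert (H2 : 0 <= (m - x) / 2) by (apply Rabs_le_between in Hmx; lra).
set (a := sqrt ((m + x) / 2)); set (b := sqrt ((m - x) / 2)).
assert (Ha : a * a = (m + x) / 2) by now apply sqrt_sqrt.
assert (Hb : b * b = (m - x) / 2) by now apply sqrt_sqrt.
assert (Hab : a * b = Rabs y / 2).
{ unfold a, b; rewrite <- sqrt_mult by assumption.
  replace ((m + x) / 2 * ((m - x) / 2)) with ((Rabs y / 2) ^ 2).
  - apply sqrt_pow2; generalize (Rabs_pos y); lra.
  - unfold Rdiv; rewrite Rpow_mult_distr, pow2_abs; lra. }
destruct (Rle_dec 0 y) as [Hy | Hy].
- rewrite Rabs_pos_eq in Hab by assumption.
  exists (a, b); unfold Cmult; simpl; f_equal; lra.
- rewrite Rabs_left in Hab by lra.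
  exists (a, - b); unfold Cmult; simpl; f_equal; lra.
Qed.

(** Ordering the roots by real part makes [Re l2] at most half of [Re T]; this is how the damping in
    the trace is passed on to [l2]. *)
Lemma quadratic_roots (T D : C) : exists l1 l2 : C,
  (l1 + l2)%C = T /\ (l1 * l2)%C = D /\ Re l2 <= Re l1.
Proof.
assert (R : exists l1 l2 : C, (l1 + l2)%C = T /\ (l1 * l2)%C = D).
{ destruct (Csqrt_exists (T * T - 4 * D)%C) as [s Hs].
  assert (H2 : RtoC 2 <> 0) by (intros H; apply RtoC_inj in H; lra).
  exists ((T + s) / 2)%C, ((T - s) / 2)%C; split.
  - field; auto.
  - replace (_ * _)%C with ((T * T - s * s) / 4)%C.
    + rewrite Hs; field; intros H; apply RtoC_inj in H; lra.
    + field; split; auto; intros H; apply RtoC_inj in H; lra. }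
destruct R as (l1 & l2 & H1 & H2).
destruct (Rle_dec (Re l2) (Re l1)).
- now exists l1, l2.
- exists l2, l1; rewrite Cplus_comm, Cmult_comm; repeat split; auto; lra.
Qed.

(** The Routh-Hurwitz criterion for [l ^ 2 - T l + D] with complex [T], [D]: for roots
    [x1 + i y1], [x2 + i y2], the expression in the second hypothesis equals
    [x1 x2 ((x1 + x2) ^ 2 + (y1 - y2) ^ 2)]. *)
Lemma hurwitz_quadratic (l1 l2 : C) :
  let T := (l1 + l2)%C in
  let D := (l1 * l2)%C in
  Re T < 0 ->
  0 <= Re T ^ 2 * Re D + Re T * Im T * Im D - Im D ^ 2 ->
  Re l1 <= 0.
Proof.
destruct l1 as [x1 y1], l2 as [x2 y2]; unfold Re, Im; simpl fst; simpl snd; intros HT H.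
assert (E : 0 <= x1 * x2 * ((x1 + x2) ^ 2 + (y1 - y2) ^ 2)).
{ match type of H with _ <= ?X => replace (_ * _) with X by ring end; exact H. }
(* If [x1 > 0], the negative trace forces [x2 < 0] and [x1 + x2 <> 0], so the expression in [E]
   would be negative. *)
apply Rnot_lt_le; intros Hx.
assert (0 < (x1 + x2) ^ 2) by nra.
assert (0 <= (y1 - y2) ^ 2) by apply pow2_ge_0.
assert (x1 * x2 < 0) by nra.
nra.
Qed.

(** The derivative is controlled at positive times only, so the mean value theorem is applied on
    [[e, T]] and [e] then tends to 0 from the right. *)
Lemma nonincreasing_from_right_limit (g dg : R -> R) (T : R) :
  0 < T -> filterlim g (at_right 0) (locally (g 0)) ->
  (forall t, 0 < t <= T -> is_derive g t (dg t) /\ dg t <= 0) ->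
  g T <= g 0.
Proof.
intros HT Hlim Hd.
apply (filterlim_le (F := at_right 0) (fun _ => g T) g (Finite (g T)) (Finite (g 0))).
- exists (mkposreal T HT); intros e He He0.
  change (Rabs (e - 0) < T) in He; apply Rabs_lt_between in He.
  destruct (MVT_gen g e T dg) as (x & Hx & E).
  + intros x; rewrite Rmin_left, Rmax_right by lra; intros Hx; apply Hd; lra.
  + intros x; rewrite Rmin_left, Rmax_right by lra; intros Hx.
    apply continuity_pt_filterlim, (ex_derive_continuous (V := R_NormedModule)).
    exists (dg x); apply Hd; lra.
  + rewrite Rmin_left, Rmax_right in Hx by lra.
    destruct (Hd x) as [_ Hle]; [lra |]; nra.
- apply filterlim_const.
- exact Hlim.
Qed.

Lemma is_derive_pair (f g : R -> R) (t a b : R) :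
  is_derive f t a -> is_derive g t b ->
  is_derive (V := C_R_NormedModule) (fun s => (f s, g s)) t (a, b).
Proof.
intros Hf Hg.
assert (E : forall x y : R, (x, y) =
  plus (G := C_R_NormedModule) (scal (V := C_R_NormedModule) x (1, 0))
       (scal (V := C_R_NormedModule) y (0, 1))).
{ intros x y; rewrite !scal_R_Cmult.
  apply injective_projections; unfold plus; simpl; unfold plus; simpl; ring. }
rewrite E; eapply is_derive_ext; [intros s; symmetry; apply E |].
apply (is_derive_plus (V := C_R_NormedModule));
  apply (is_derive_scal_l (V := C_R_NormedModule)); assumption.
Qed.

Lemma is_derive_Cexp_line (l : C) (t : R) :
  is_derive (V := C_R_NormedModule) (fun s => Cexp (l * s)%C) t (l * Cexp (l * t))%C.
Proof.
destruct l as [a b].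
assert (E : forall s : R, Cexp ((a, b) * s)%C =
  (exp (a * s) * cos (b * s), exp (a * s) * sin (b * s))).
{ intros s; unfold Cexp, Cmult, Re, Im; simpl.
  replace (a * s - b * 0) with (a * s) by ring.
  now replace (a * 0 + b * s) with (b * s) by ring. }
rewrite E; eapply is_derive_ext; [intros s; symmetry; apply E |].
apply is_derive_pair; auto_derive; auto; simpl; ring.
Qed.

Lemma Cmod_Cexp (z : C) : Cmod (Cexp z) = exp (Re z).
Proof.
unfold Cmod, Cexp; simpl.
match goal with |- sqrt ?x = _ => replace x with (exp (Re z) ^ 2) end.
- apply sqrt_pow2, Rlt_le, exp_pos.
- generalize (sin2_cos2 (Im z)); unfold Rsqr; intros H.
  transitivity (exp (Re z) ^ 2 * (sin (Im z) * sin (Im z) + cos (Im z) * cos (Im z)));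
  [rewrite H |]; ring.
Qed.

(** With [k] the conjugate of [z T], [Re (k e^(mu (T - t)) z t)] vanishes at [0], equals
    [|z T| ^ 2] at [T], and grows at most like [|z T|] times [E]. *)
Lemma duhamel_bound (mu : C) (z f : R -> C) (E dE : R -> R) (d F T : R) :
  0 < T -> Re mu <= - d ->
  z 0 = RtoC 0 -> filterlim z (at_right 0) (locally (T := C_R_NormedModule) (z 0)) ->
  (forall t, 0 < t -> is_derive (V := C_R_NormedModule) z t (mu * z t + f t)%C) ->
  (forall t, 0 < t -> Cmod (f t) <= F) ->
  (forall t, is_derive E t (dE t)) ->
  (forall t, dE t = F * exp (- d * (T - t))) ->
  Cmod (z T) <= E T - E 0.
Proof.
intros HT Hmu Hz0 Hlim Hz Hf HE HdE.
set (k := Cconj (z T)).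
set (w := fun t => (k * Cexp (mu * (T - t)%R))%C).
set (g := fun t => Re (w t * z t) - Cmod (z T) * E t).
set (dg := fun t => Re (w t * f t) - Cmod (z T) * dE t).
assert (Hw : forall t, Cmod (w t) = Cmod (z T) * exp (Re mu * (T - t))).
{ intros t; unfold w, k; rewrite Cmod_mult, Cmod_conj, Cmod_Cexp; f_equal; f_equal.
  unfold Re, Cmult; simpl; ring. }
assert (Hdw : forall t, is_derive (fun s => Re (w s)) t (- Re (w t * mu)%C) /\
                        is_derive (fun s => Im (w s)) t (- Im (w t * mu)%C)).
{ intros t; unfold w; destruct k as [k1 k2], mu as [m1 m2].
  assert (E1 : forall s : R, Cexp ((m1, m2) * (T - s)%R)%C =
    (exp (m1 * (T - s)) * cos (m2 * (T - s)), exp (m1 * (T - s)) * sin (m2 * (T - s)))).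
  { intros s; unfold Cexp, Cmult, Re, Im; simpl.
    replace (m1 * (T - s) - m2 * 0) with (m1 * (T - s)) by ring.
    now replace (m1 * 0 + m2 * (T - s)) with (m2 * (T - s)) by ring. }
  split; (eapply is_derive_ext; [intros s; rewrite E1; reflexivity |]); rewrite E1;
    unfold Cmult, Re, Im; simpl; auto_derive; auto;
    replace (T + - t) with (T - t) by ring; ring. }
assert (HF : 0 <= F) by (apply Rle_trans with (2 := Hf 1 Rlt_0_1); apply Cmod_ge_0).
assert (Hg : g T <= g 0).
{ apply (nonincreasing_from_right_limit g dg T HT).
  - assert (L1 : filterlim (fun t => fst (z t)) (at_right 0) (locally (fst (z 0)))).
    { apply (filterlim_comp _ _ _ z fst _ _ _ Hlim).
      apply (continuous_fst (U := R_UniformSpace) (V := R_UniformSpace)). }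
    assert (L2 : filterlim (fun t => snd (z t)) (at_right 0) (locally (snd (z 0)))).
    { apply (filterlim_comp _ _ _ z snd _ _ _ Hlim).
      apply (continuous_snd (U := R_UniformSpace) (V := R_UniformSpace)). }
    assert (C0 : forall h : R -> R, ex_derive h 0 ->
      filterlim h (at_right 0) (locally (h 0))).
    { intros h Hh; apply (filterlim_filter_le_1 h (filter_le_within (F := locally 0) (fun x => 0 < x))).
      now apply (ex_derive_continuous (V := R_NormedModule)). }
    assert (M : forall h1 h2 : R -> R, filterlim h1 (at_right 0) (locally (h1 0)) ->
      filterlim h2 (at_right 0) (locally (h2 0)) ->
      filterlim (fun t => h1 t * h2 t) (at_right 0) (locally (h1 0 * h2 0))).
    { intros h1 h2 A B; eapply filterlim_comp_2; [exact A | exact B |].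
      apply (filterlim_mult (K := R_AbsRing)). }
    assert (S : forall h1 h2 : R -> R, filterlim h1 (at_right 0) (locally (h1 0)) ->
      filterlim h2 (at_right 0) (locally (h2 0)) ->
      filterlim (fun t => h1 t - h2 t) (at_right 0) (locally (h1 0 - h2 0))).
    { intros h1 h2 A B; eapply (filterlim_comp_2 h1 (fun t => - h2 t) Rplus); [exact A | |].
      - apply (filterlim_comp _ _ _ h2 Ropp _ _ _ B).
        apply (filterlim_opp (V := R_NormedModule)).
      - apply (filterlim_plus (V := R_NormedModule)). }
    unfold g.
    apply (S (fun t => Re (w t * z t)) (fun t => Cmod (z T) * E t)).
    + apply (S (fun t => Re (w t) * fst (z t)) (fun t => Im (w t) * snd (z t)));
        [apply (M (fun t => Re (w t)) (fun t => fst (z t))) |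
         apply (M (fun t => Im (w t)) (fun t => snd (z t)))]; auto; apply C0;
        eexists; apply Hdw.
    + apply (M (fun _ => Cmod (z T)) E).
      * apply filterlim_const.
      * apply C0; eexists; apply HE.
  - intros t Ht; split.
    + assert (D1 : is_derive (fun s => fst (z s)) t (fst (mu * z t + f t)%C)).
      { apply (is_derive_comp_linear C_R_NormedModule R_NormedModule R_NormedModule z fst).
        - apply (is_linear_fst (U := R_NormedModule) (V := R_NormedModule)).
        - apply Hz; lra. }
      assert (D2 : is_derive (fun s => snd (z s)) t (snd (mu * z t + f t)%C)).
      { apply (is_derive_comp_linear C_R_NormedModule R_NormedModule R_NormedModule z snd).
        - apply (is_linear_snd (U := R_NormedModule) (V := R_NormedModule)).
        - apply Hz; lra. }
      destruct (Hdw t) as [D3 D4].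
      unfold g.
      (* The weight satisfies [w' = - mu w], which cancels the term [mu z] in the product rule: only
         the forcing [f] remains in [dg]. *)
      replace (dg t) with
       ((- Re (w t * mu)%C * fst (z t) + Re (w t) * fst (mu * z t + f t)%C)
        - (- Im (w t * mu)%C * snd (z t) + Im (w t) * snd (mu * z t + f t)%C)
        - Cmod (z T) * dE t)
       by (unfold dg, Re, Im, Cmult, Cplus; simpl; ring).
      apply (is_derive_minus (V := R_NormedModule)).
      * apply (is_derive_minus (V := R_NormedModule) (fun s => Re (w s) * fst (z s))
          (fun s => Im (w s) * snd (z s)));
        apply (is_derive_mult (K := R_AbsRing)); auto; apply Rmult_comm.
      * apply is_derive_scal; auto.
    + unfold dg; rewrite HdE.
      apply Rle_minus.
      apply Rle_trans with (Cmod (w t * f t)).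
      { apply Rle_trans with (1 := Rle_abs _), re_le_Cmod. }
      rewrite Cmod_mult, Hw.
      assert (exp (Re mu * (T - t)) <= exp (- d * (T - t))).
      { destruct (Req_dec t T) as [-> | Hn].
        - rewrite !Rminus_diag, !Rmult_0_r; lra.
        - destruct (Req_dec (Re mu) (- d)) as [-> | Hn']; [lra |].
          apply Rlt_le, exp_increasing; nra. }
      rewrite Rmult_assoc; apply Rmult_le_compat_l; [apply Cmod_ge_0 |].
      rewrite (Rmult_comm F).
      apply Rmult_le_compat; auto; [apply Rlt_le, exp_pos | apply Cmod_ge_0 |].
      apply Hf; lra. }
assert (Hw0 : Re (w T * z T) = Cmod (z T) ^ 2).
{ unfold w, k; rewrite Rminus_diag.
  replace (Cexp (mu * 0)) with (RtoC 1).
  - transitivity (Re (z T * Cconj (z T))); [f_equal; ring |].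
    now rewrite <- Cmod2_conj.
  - unfold Cexp, Re, Im; simpl.
    replace (fst mu * 0 - snd mu * 0) with 0 by ring.
    replace (fst mu * 0 + snd mu * 0) with 0 by ring.
    rewrite exp_0, cos_0, sin_0; unfold RtoC; f_equal; ring. }
assert (Hz00 : Re (w 0 * z 0) = 0) by (rewrite Hz0, Cmult_0_r; reflexivity).
unfold g in Hg; rewrite Hw0, Hz00 in Hg.
assert (Hc := Cmod_ge_0 (z T)).
(* For [z T <> 0] the inequality [Hg] is divided by [Cmod (z T)]. For [z T = 0] it is void, and the
   claim reduces to [E 0 <= E T], which holds as [dE >= 0]. *)
destruct (Rle_lt_or_eq_dec _ _ Hc) as [Hp | <-].
- apply Rmult_le_reg_l with (Cmod (z T)); [exact Hp | nra].
- assert (Hinc : - E T <= - E 0).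
  { apply (nonincreasing_from_right_limit (fun t => - E t) (fun t => - dE t) T HT).
    - apply (filterlim_filter_le_1 _ (filter_le_within (F := locally 0) (fun x => 0 < x))).
      apply (ex_derive_continuous (V := R_NormedModule) (fun t => - E t)).
      exists (- dE 0); apply (is_derive_opp (V := R_NormedModule) E), HE.
    - intros t _; split; [apply (is_derive_opp (V := R_NormedModule) E), HE |].
      rewrite HdE; generalize (exp_pos (- d * (T - t))); nra. }
  lra.
Qed.

(** The rate [d = 0], with primitive [E t = F t]: without damping the forcing accumulates linearly
    in time. *)
Lemma duhamel_bound_neutral (mu : C) (z f : R -> C) (F T : R) :
  0 < T -> Re mu <= 0 ->
  z 0 = RtoC 0 -> filterlim z (at_right 0) (locally (T := C_R_NormedModule) (z 0)) ->
  (forall t, 0 < t -> is_derive (V := C_R_NormedModule) z t (mu * z t + f t)%C) ->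
  (forall t, 0 < t -> Cmod (f t) <= F) ->
  Cmod (z T) <= F * T.
Proof.
intros HT Hmu H0 H1 H2 H3.
replace (F * T) with (F * T - F * 0) by ring.
apply (duhamel_bound mu z f (fun t => F * t) (fun _ => F) 0 F T); auto.
- lra.
- intros t; auto_derive; auto; ring.
- intros t; rewrite Ropp_0, Rmult_0_l, exp_0; ring.
Qed.

(** Here the primitive is [F / d * exp (- d * (T - t))]. Dropping its nonnegative value at 0 leaves
    a bound uniform in [T]. *)
Lemma duhamel_bound_damped (mu : C) (z f : R -> C) (d F T : R) :
  0 < T -> 0 < d -> Re mu <= - d ->
  z 0 = RtoC 0 -> filterlim z (at_right 0) (locally (T := C_R_NormedModule) (z 0)) ->
  (forall t, 0 < t -> is_derive (V := C_R_NormedModule) z t (mu * z t + f t)%C) ->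
  (forall t, 0 < t -> Cmod (f t) <= F) ->
  Cmod (z T) <= F / d.
Proof.
intros HT Hd Hmu H0 H1 H2 H3.
assert (HF : 0 <= F) by (apply Rle_trans with (2 := H3 1 Rlt_0_1); apply Cmod_ge_0).
set (E := fun t => F / d * exp (- d * (T - t))).
apply Rle_trans with (E T - E 0).
- apply (duhamel_bound mu z f E (fun t => F * exp (- d * (T - t))) d F T); auto.
  intros t; unfold E; auto_derive; auto.
  replace (T + - t) with (T - t) by ring; field; lra.
- unfold E; rewrite Rminus_diag, Rmult_0_r, exp_0.
  assert (0 <= F / d) by (apply Rdiv_le_0_compat; auto).
  generalize (exp_pos (- d * (T - 0))); nra.
Qed.

Lemma filterlim_linear (U V : NormedModule R_AbsRing) (L : U -> V) (f : R -> U)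
    (F : (R -> Prop) -> Prop) (x : U) : Filter F ->
  is_linear L -> filterlim f F (locally x) -> filterlim (fun t => L (f t)) F (locally (L x)).
Proof.
intros HF HL Hf; apply (filterlim_comp _ _ _ f L _ _ _ Hf).
apply (filterdiff_continuous (K := R_AbsRing) L x).
exists L; now apply filterdiff_linear.
Qed.

Lemma filterlim_Cminus (f g : R -> C_R_NormedModule) (F : (R -> Prop) -> Prop)
    (x y : C_R_NormedModule) : Filter F ->
  filterlim f F (locally x) -> filterlim g F (locally y) ->
  filterlim (fun t => (f t - g t)%C) F (locally (x - y)%C : (C -> Prop) -> Prop).
Proof.
intros HF Hf Hg.
eapply (filterlim_comp_2 f (fun t => Copp (g t)) Cplus); [exact Hf | |].
- apply (filterlim_comp _ _ _ g Copp _ _ _ Hg (filterlim_opp (V := C_R_NormedModule) y)).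
- apply (filterlim_plus (V := C_R_NormedModule)).
Qed.

(** As [(1, p)] is an eigenvector of [A], the error equation is triangular in the
    coordinates [(e1, e2 - p e1)]. *)
Lemma ivp_error_bound (A : matrix 2 2) (v0 : CC) (v : R -> CC) (l l1 l2 p : C) (d T : R) :
  let a i j := coeff_mat (RtoC 0) A i j in
  let r1 := ((l - a 0%nat 0%nat) * fst v0 - a 0%nat 1%nat * snd v0)%C in
  let r2 := ((l - a 1%nat 1%nat) * snd v0 - a 1%nat 0%nat * fst v0)%C in
  let e1 := (Cexp (l * T) * fst v0 - fst (v T))%C in
  let e2 := (Cexp (l * T) * snd v0 - snd (v T))%C in
  let Y := Cmod (r2 - p * r1) / d in
  solves_ivp A v0 v -> 0 < T -> 0 < d ->
  Re l <= 0 -> Re l1 <= 0 -> Re l2 <= - d ->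
  (a 0%nat 0%nat + a 0%nat 1%nat * p)%C = l1 ->
  (a 1%nat 1%nat - p * a 0%nat 1%nat)%C = l2 ->
  (a 1%nat 0%nat + a 1%nat 1%nat * p)%C = (p * l1)%C ->
  Cmod (e2 - p * e1) <= Y /\ Cmod e1 <= (Cmod (a 0%nat 1%nat) * Y + Cmod r1) * T.
Proof.
intros a r1 r2 e1 e2 Y (Hv0 & Hlim & Hd) HT Hdpos Hl Hl1 Hl2 E1 E2 E3.
set (x := fun t : R => (Cexp (l * t) * fst v0 - fst (v t))%C).
set (y := fun t : R => (Cexp (l * t) * snd v0 - snd (v t) - x t * p)%C).
assert (DE : forall (k : C) t, is_derive (V := C_R_NormedModule)
   (fun s : R => Cexp (l * s) * k)%C t (l * Cexp (l * t) * k)%C).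
{ intros k t; apply (is_derive_comp_linear C_R_NormedModule C_R_NormedModule
    C_R_NormedModule (fun s : R => Cexp (l * s)) (fun u => u * k)%C).
  - apply is_linear_Cmult_r.
  - apply is_derive_Cexp_line. }
assert (LE : forall k : C, filterlim (fun s : R => Cexp (l * s) * k)%C (at_right 0)
   (locally (T := C_R_NormedModule) (Cexp (l * 0) * k)%C)).
{ intros k; apply (filterlim_filter_le_1 _ (filter_le_within (F := locally 0) (fun x => 0 < x))).
  apply (ex_derive_continuous (V := C_R_NormedModule) (fun s : R => Cexp (l * s) * k)%C).
  eexists; apply DE. }
assert (L1 : filterlim (fun t => fst (v t)) (at_right 0)
  (locally (T := C_R_NormedModule) (fst (v 0)))).
{ apply (filterlim_linear CC C_R_NormedModule fst); auto; [apply at_right_proper_filter |].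
  apply is_linear_fst. }
assert (L2 : filterlim (fun t => snd (v t)) (at_right 0)
  (locally (T := C_R_NormedModule) (snd (v 0)))).
{ apply (filterlim_linear CC C_R_NormedModule snd); auto; [apply at_right_proper_filter |].
  apply is_linear_snd. }
assert (D1 : forall t, 0 < t -> is_derive (V := C_R_NormedModule) (fun t => fst (v t)) t
   (fst (mulmv A (v t)))).
{ intros t Ht; apply (is_derive_comp_linear CC C_R_NormedModule C_R_NormedModule v fst).
  - apply is_linear_fst.
  - now apply Hd. }
assert (D2 : forall t, 0 < t -> is_derive (V := C_R_NormedModule) (fun t => snd (v t)) t
   (snd (mulmv A (v t)))).
{ intros t Ht; apply (is_derive_comp_linear CC C_R_NormedModule C_R_NormedModule v snd).
  - apply is_linear_snd.
  - now apply Hd. }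
assert (Lx : filterlim x (at_right 0) (locally (T := C_R_NormedModule) (x 0))).
{ apply filterlim_Cminus; auto; apply at_right_proper_filter. }
assert (Ly : filterlim y (at_right 0) (locally (T := C_R_NormedModule) (y 0))).
{ apply filterlim_Cminus; [apply at_right_proper_filter | |].
  - apply filterlim_Cminus; auto; apply at_right_proper_filter.
  - apply (filterlim_linear C_R_NormedModule C_R_NormedModule (fun u => u * p)%C x);
      auto; [apply at_right_proper_filter | apply is_linear_Cmult_r]. }
assert (M1 : forall u : CC, fst (mulmv A u) = (a 0%nat 0%nat * fst u + a 0%nat 1%nat * snd u)%C)
  by reflexivity.
assert (M2 : forall u : CC, snd (mulmv A u) = (a 1%nat 0%nat * fst u + a 1%nat 1%nat * snd u)%C)
  by reflexivity.
assert (Dx0 : forall t, 0 < t -> is_derive (V := C_R_NormedModule) x t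
   (l * Cexp (l * t) * fst v0 - fst (mulmv A (v t)))%C).
{ intros t Ht; apply (is_derive_minus (V := C_R_NormedModule)); auto. }
assert (Dx : forall t, 0 < t -> is_derive (V := C_R_NormedModule) x t
   (l1 * x t + (a 0%nat 1%nat * y t + r1 * Cexp (l * t)))%C).
(* Substituting [e2 = y + p e1] in the first row gives [e1] the coefficient [a00 + a01 p = l1]. *)
{ intros t Ht; replace (_ + _)%C with
   (l * Cexp (l * t) * fst v0 - fst (mulmv A (v t)))%C; auto.
  rewrite <- E1, M1; unfold y, x, r1; ring. }
assert (Dy : forall t, 0 < t -> is_derive (V := C_R_NormedModule) y t
   (l2 * y t + (r2 - p * r1) * Cexp (l * t))%C).
{ intros t Ht; replace (_ + _)%C with
   (l * Cexp (l * t) * snd v0 - snd (mulmv A (v t))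
    - (l * Cexp (l * t) * fst v0 - fst (mulmv A (v t))) * p)%C.
  - apply (is_derive_minus (V := C_R_NormedModule)).
    + apply (is_derive_minus (V := C_R_NormedModule)); auto.
    + apply (is_derive_comp_linear C_R_NormedModule C_R_NormedModule
        C_R_NormedModule x (fun u => u * p)%C); auto using is_linear_Cmult_r.
  - assert (E3' : ((a 1%nat 0%nat + a 1%nat 1%nat * p) * x t = p * l1 * x t)%C)
      by now rewrite E3.
    rewrite <- E1 in E3'; rewrite <- E2.
    (* The coefficient of [x t] is the second row of [A (1, p)] minus [p] times the first row; it
       vanishes by the eigenvector relation. *)
    transitivity ((a 1%nat 1%nat - p * a 0%nat 1%nat) * y t
      + (r2 - p * r1) * Cexp (l * t)
      + ((a 1%nat 0%nat + a 1%nat 1%nat * p) * x t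
         - p * (a 0%nat 0%nat + a 0%nat 1%nat * p) * x t))%C.
    + rewrite M1, M2; unfold y, x, r1, r2; ring.
    + rewrite E3'; ring. }
assert (E0 : Cexp (l * 0) = RtoC 1).
{ unfold Cexp, Re, Im; simpl.
  replace (fst l * 0 - snd l * 0) with 0 by ring.
  replace (fst l * 0 + snd l * 0) with 0 by ring.
  rewrite exp_0, cos_0, sin_0; unfold RtoC; f_equal; ring. }
assert (x0 : x 0 = RtoC 0) by (unfold x; rewrite Hv0, E0; ring).
assert (y0 : y 0 = RtoC 0) by (unfold y; rewrite x0, Hv0, E0; ring).
assert (HE : forall t, 0 < t -> Cmod (Cexp (l * t)) <= 1).
{ intros t Ht; rewrite Cmod_Cexp, <- exp_0.
  replace (Re (l * t)%C) with (Re l * t) by (unfold Re; simpl; ring).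
  destruct (Req_dec (Re l * t) 0) as [-> | Hn]; [lra |].
  apply Rlt_le, exp_increasing; nra. }
assert (Hy : forall t, 0 < t -> Cmod (y t) <= Y).
{ intros t Ht; apply (duhamel_bound_damped l2 y (fun s => (r2 - p * r1) * Cexp (l * s))%C); auto.
  intros s Hs; rewrite Cmod_mult; generalize (HE s Hs) (Cmod_ge_0 (r2 - p * r1)%C); nra. }
split.
- replace (e2 - p * e1)%C with (y T) by (unfold y, x, e1, e2; ring); auto.
- apply (duhamel_bound_neutral l1 x
    (fun s => a 0%nat 1%nat * y s + r1 * Cexp (l * s))%C); auto.
  intros s Hs; eapply Rle_trans; [apply Cmod_triangle |]; rewrite !Cmod_mult.
  generalize (HE s Hs) (Hy s Hs) (Cmod_ge_0 r1) (Cmod_ge_0 (a 0%nat 1%nat)).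
  intros; apply Rplus_le_compat; nra.
Qed.

(** * Stability of the Fourier matrix *)

Lemma Cinv_unit (x y : R) : x ^ 2 + y ^ 2 = 1 -> Cinv (x, y) = (x, - y).
Proof.
intros H; unfold Cinv; simpl fst; simpl snd; rewrite H; f_equal; field.
Qed.

(** On the unit circle inversion is conjugation, so the entries are trigonometric polynomials,
    reduced by [S ^ 2 = 1 - C ^ 2]. This form displays the factors [1 - C] and [S], which vanish at
    [xi = 0]. *)
Lemma fourier_matrix_entries (c kappa0 dx xi : R) :
  let alpha := c / dx in
  let beta := kappa0 / dx ^ 2 in
  let C := cos xi in
  let S := sin xi in
  let g := coeff_mat (RtoC 0) (fourier_matrix c kappa0 dx xi) in
  g 0%nat 0%nat = (- 4 * beta * (1 - C), 0) /\
  g 0%nat 1%nat = (- alpha * (1 - C) + beta * (1 - C) * (1 + C),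
                   - alpha * S - beta * (1 - C) * S) /\
  g 1%nat 0%nat = (alpha * (3 - C) + 8 * beta * (1 + C), - alpha * S + 8 * beta * S) /\
  g 1%nat 1%nat = (- alpha * (4 + 2 * C) / 3 - beta * (38 + 10 * C) / 3, alpha * S).
Proof.
intros alpha beta C S g.
assert (HS : S ^ 2 = 1 - C ^ 2).
{ generalize (sin2_cos2 xi); unfold Rsqr, S, C; lra. }
assert (Hinv : Cinv (C, S) = (C, - S)) by (apply Cinv_unit; lra).
assert (Hinv2 : Cinv (Cpow (C, S) 2) = (C ^ 2 - S ^ 2, - 2 * C * S)).
{ rewrite <- Cpow_inv; [| intros H; injection H; intros; nra].
  rewrite Hinv; simpl; unfold Cmult; simpl; f_equal; ring. }
unfold g, fourier_matrix, G_adv, G_diff, mat2, coeff_mat, mk_matrix.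
cbn -[pow Cpow]; rewrite !waveE, Rmult_1_r; fold C S alpha beta.
rewrite Hinv2, Hinv.
assert (H2 : Cinv 2 = (/ 2, 0)) by (rewrite <- RtoC_inv by lra; reflexivity).
assert (H3 : Cinv 3 = (/ 3, 0)) by (rewrite <- RtoC_inv by lra; reflexivity).
assert (H6 : Cinv 6 = (/ 6, 0)) by (rewrite <- RtoC_inv by lra; reflexivity).
rewrite H2, H3, H6.
repeat split; apply injective_projections; simpl; field_simplify; trivial;
  replace (S * (S * 1)) with (S ^ 2) by ring; try rewrite HS; field.
Qed.

(** Here [T] and [D] are the trace and determinant of [G] at [C = cos xi], [S = sin xi]:
    up to the factor [1 - C], the Hurwitz expression is a polynomial in [alpha], [beta]
    whose coefficients are nonnegative for [-1 <= C <= 1]. *)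
Lemma hurwitz_symbol (alpha beta C S : R) :
  0 < alpha -> 0 < beta -> -1 <= C <= 1 -> S ^ 2 = 1 - C ^ 2 ->
  let ReT := - (alpha * (4 + 2 * C) + beta * (50 - 2 * C)) / 3 in
  let ReD := (1 - C) * (4 * alpha ^ 2 + alpha * beta * (10 + 2 * C) / 3
                        + beta ^ 2 * (104 - 8 * C) / 3) in
  let ImT := alpha * S in
  let ImD := S * (2 * alpha ^ 2 + 16 * alpha * beta) in
  0 <= ReT ^ 2 * ReD + ReT * ImT * ImD - ImD ^ 2.
Proof.
intros Ha Hb HC HS ReT ReD ImT ImD.
assert (C2 : 0 <= C ^ 2 <= 1) by nra.
assert (C3 : - 1 <= C ^ 3 <= 1) by (replace (C ^ 3) with (C * C ^ 2) by ring; nra).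
replace (ReT ^ 2 * ReD + ReT * ImT * ImD - ImD ^ 2) with
 ((1 - C) *
  (beta ^ 4 * (260000 - 40800 * C + 2016 * C ^ 2 - 32 * C ^ 3)
   + alpha * beta ^ 3 * (66600 + 18936 * C - 2664 * C ^ 2 + 72 * C ^ 3)
   + alpha ^ 2 * beta ^ 2 * (21552 - 12048 * C + 912 * C ^ 2 - 48 * C ^ 3)
   + alpha ^ 3 * beta * (1756 - 1056 * C - 276 * C ^ 2 + 8 * C ^ 3)
   + alpha ^ 4 * (12 * (1 - C) ^ 2)) / 27).
(* The bounds on [C], [C ^ 2] and [C ^ 3] suffice for each bracket; that of [alpha ^ 3 * beta], for
   instance, is at least [1756 - 1056 - 276 - 8]. *)
- assert (0 < alpha ^ 2 /\ 0 < alpha ^ 3 /\ 0 < alpha ^ 4 /\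
          0 < beta ^ 2 /\ 0 < beta ^ 3 /\ 0 < beta ^ 4)
    by (repeat split; now apply pow_lt).
  assert (0 <= (1 - C) ^ 2) by apply pow2_ge_0.
  apply Rdiv_le_0_compat; [| lra].
  apply Rmult_le_pos; [lra |].
  repeat apply Rplus_le_le_0_compat; repeat apply Rmult_le_pos; lra.
- unfold ReT, ReD, ImT, ImD.
  (* [ImT] and [ImD] both carry a factor [S], so [S] enters only through [S ^ 2] and can be
     eliminated. *)
  transitivity
   ((- (alpha * (4 + 2 * C) + beta * (50 - 2 * C)) / 3) ^ 2 *
    ((1 - C) * (4 * alpha ^ 2 + alpha * beta * (10 + 2 * C) / 3
                        + beta ^ 2 * (104 - 8 * C) / 3))
    + S ^ 2 * ((- (alpha * (4 + 2 * C) + beta * (50 - 2 * C)) / 3) * alpha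
       * (2 * alpha ^ 2 + 16 * alpha * beta) - (2 * alpha ^ 2 + 16 * alpha * beta) ^ 2)).
  + rewrite HS; field.
  + ring.
Qed.

(** The slope is [p = m / (l1 - n)], and the characteristic equation makes [(1, p)] an eigenvector.
    By the trace, [l1 - n = a - l2], whose real part stays above a multiple of [beta]; hence [p] is
    well defined and bounded in terms of [alpha / beta]. *)
Lemma fourier_matrix_invariant_line (c kappa0 dx xi : R) :
  0 < c -> 0 < kappa0 -> 0 < dx ->
  let alpha := c / dx in
  let beta := kappa0 / dx ^ 2 in
  let g := coeff_mat (RtoC 0) (fourier_matrix c kappa0 dx xi) in
  exists l1 l2 p : C,
    (g 0%nat 0%nat + g 0%nat 1%nat * p)%C = l1 /\
    (g 1%nat 1%nat - p * g 0%nat 1%nat)%C = l2 /\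
    (g 1%nat 0%nat + g 1%nat 1%nat * p)%C = (p * l1)%C /\
    Re l1 <= 0 /\ Re l2 <= - (8 * beta) /\
    Cmod p * (2 / 3 * beta) <= 4 * alpha + 16 * beta.
Proof.
intros Hc Hk Hdx alpha beta g.
assert (Ha : 0 < alpha) by now apply Rdiv_lt_0_compat.
assert (Hb : 0 < beta) by (apply Rdiv_lt_0_compat; auto; now apply pow_lt).
destruct (fourier_matrix_entries c kappa0 dx xi) as (G00 & G01 & G10 & G11).
fold alpha beta g in G00, G01, G10, G11.
set (C := cos xi) in *; set (S := sin xi) in *.
assert (HC : -1 <= C <= 1) by apply COS_bound.
assert (HS : S ^ 2 = 1 - C ^ 2).
{ generalize (sin2_cos2 xi); unfold Rsqr, S, C; lra. }
set (a := g 0%nat 0%nat) in *; set (b := g 0%nat 1%nat) in *.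
set (m := g 1%nat 0%nat) in *; set (n := g 1%nat 1%nat) in *.
destruct (quadratic_roots (a + n)%C (a * n - b * m)%C) as (l1 & l2 & HT & HD & Hle).
assert (ReT : Re (a + n)%C = - (alpha * (4 + 2 * C) + beta * (50 - 2 * C)) / 3)
  by (rewrite G00, G11; simpl; field).
assert (ImT : Im (a + n)%C = alpha * S) by (rewrite G00, G11; simpl; ring).
assert (ReD : Re (a * n - b * m)%C =
  (1 - C) * (4 * alpha ^ 2 + alpha * beta * (10 + 2 * C) / 3
             + beta ^ 2 * (104 - 8 * C) / 3)).
{ rewrite G00, G01, G10, G11; unfold Cminus, Cplus, Cmult, Copp, Re; simpl fst; simpl snd.
  match goal with |- ?L = ?R =>
    replace L with (R - (S ^ 2 - (1 - C ^ 2)) *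
      ((alpha + beta * (1 - C)) * (8 * beta - alpha))) end.
  - rewrite HS; ring.
  - field. }
assert (ImD : Im (a * n - b * m)%C = S * (2 * alpha ^ 2 + 16 * alpha * beta)).
{ rewrite G00, G01, G10, G11; unfold Cminus, Cplus, Cmult, Copp, Im; simpl fst; simpl snd.
  field. }
assert (Hl1 : Re l1 <= 0).
{ apply (hurwitz_quadratic l1 l2); rewrite HT, ?HD, ReT.
  - nra.
  - rewrite ImT, ReD, ImD; now apply hurwitz_symbol. }
assert (Hsum : Re l1 + Re l2 = Re (a + n)%C) by (rewrite <- HT; reflexivity).
(* Half of the real trace, with its negative [alpha] term dropped; since [C <= 1], this is at most
   [- 8 * beta]. *)
assert (Hl2 : Re l2 <= - beta * (50 - 2 * C) / 6) by (rewrite ReT in Hsum; nra).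
(* The lower bound is [beta * (13 + 11 * C) / 3], whose worst case [C = -1] gives [2 / 3]. *)
assert (Hq : 2 / 3 * beta <= Re (l1 - n)%C).
{ replace (l1 - n)%C with (a - l2)%C.
  - rewrite G00; unfold Re in *; simpl; nra.
  - replace (a - l2)%C with (a + n - n - l2)%C by ring; rewrite <- HT; ring. }
assert (Hn0 : (l1 - n)%C <> RtoC 0).
{ intros E; rewrite E in Hq; unfold Re, RtoC in Hq; simpl in Hq; lra. }
set (p := (m / (l1 - n))%C).
assert (E1 : (a + b * p)%C = l1).
{ assert (Hbm : (b * m = a * n - l1 * (a + n - l1))%C).
  { replace (a + n - l1)%C with l2 by (rewrite <- HT; ring); rewrite HD; ring. }
  unfold p; replace (b * (m / (l1 - n)))%C with (b * m / (l1 - n))%C by (field; auto).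
  rewrite Hbm; field; auto. }
exists l1, l2, p; repeat split; auto.
- transitivity (a + n - (a + b * p))%C; [ring |].
  rewrite E1, <- HT; ring.
- unfold p; field; auto.
- nra.
- assert (Hp : (p * (l1 - n))%C = m) by (unfold p; field; auto).
  apply Rle_trans with (Cmod m).
  + rewrite <- Hp, Cmod_mult; apply Rmult_le_compat_l; [apply Cmod_ge_0 |].
    apply Rle_trans with (1 := Hq).
    apply Rle_trans with (1 := Rle_abs _), re_le_Cmod.
  + rewrite G10; unfold Cmod; simpl fst; simpl snd.
    rewrite <- (sqrt_pow2 (4 * alpha + 16 * beta)) by lra.
    apply sqrt_le_1_alt.
    replace ((- alpha * S + 8 * beta * S) ^ 2) with (S ^ 2 * (8 * beta - alpha) ^ 2) by ring.
    rewrite HS.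
    replace ((alpha * (3 - C) + 8 * beta * (1 + C)) ^ 2 + (1 - C ^ 2) * (8 * beta - alpha) ^ 2)
      with (alpha ^ 2 * (10 - 6 * C) + 128 * beta ^ 2 * (1 + C) + 32 * (alpha * beta) * (1 + C)) by ring.
    assert (0 < alpha * beta) by now apply Rmult_lt_0_compat.
    assert (0 <= alpha ^ 2) by apply pow2_ge_0.
    assert (0 <= beta ^ 2) by apply pow2_ge_0.
    nra.
Qed.

Lemma Rabs_sin_le (x : R) : Rabs (sin x) <= Rabs x.
Proof.
assert (P : forall y, 0 < y -> Rabs (sin y) <= y).
{ intros y Hy; apply Rabs_le; split.
  - destruct (Rle_dec y PI).
    + assert (0 <= sin y) by (apply sin_ge_0; lra); lra.
    + generalize (SIN_bound y) PI2_1; lra.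
  - apply Rlt_le, sin_lt_x, Hy. }
destruct (Rtotal_order x 0) as [H | [-> | H]].
- rewrite <- Rabs_Ropp, <- sin_neg, <- (Rabs_Ropp x), (Rabs_pos_eq (- x)) by lra.
  apply P; lra.
- rewrite sin_0; lra.
- rewrite (Rabs_pos_eq x) by lra; now apply P.
Qed.

(** With [xi = w * dx], the advective part has modulus at most [alpha |xi|] and the diffusive part
    at most [2 * beta * (1 - C) <= beta * xi ^ 2], since [1 - C = 2 sin (xi / 2) ^ 2]. All powers of
    [dx] cancel. *)
Lemma fourier_matrix_01_bound (c kappa0 dx w : R) :
  0 < c -> 0 < kappa0 -> 0 < dx ->
  Cmod (coeff_mat (RtoC 0) (fourier_matrix c kappa0 dx (w * dx)) 0%nat 1%nat)
  <= c * Rabs w + kappa0 * w ^ 2.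
Proof.
intros Hc Hk Hdx; destruct (fourier_matrix_entries c kappa0 dx (w * dx)) as (_ & -> & _ & _).
set (alpha := c / dx); set (beta := kappa0 / dx ^ 2).
assert (Ha : 0 < alpha) by now apply Rdiv_lt_0_compat.
assert (Hb : 0 < beta) by (apply Rdiv_lt_0_compat; auto; now apply pow_lt).
set (C := cos (w * dx)); set (S := sin (w * dx)).
assert (HC : -1 <= C <= 1) by apply COS_bound.
assert (HS : S ^ 2 = 1 - C ^ 2).
{ generalize (sin2_cos2 (w * dx)); unfold Rsqr, S, C; lra. }
assert (HC2 : 2 * (1 - C) <= (w * dx) ^ 2).
{ unfold C; replace (w * dx) with (2 * (w * dx / 2)) at 1 by field.
  rewrite cos_2a_sin.
  generalize (pow_maj_Rabs _ _ 2 (Rabs_sin_le (w * dx / 2))).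
  rewrite pow2_abs; nra. }
replace (_, _) with (Cplus (alpha * (C - 1), - alpha * S)
                           (beta * (1 - C) * (1 + C), - beta * (1 - C) * S))
  by (unfold Cplus; simpl; f_equal; ring).
apply Rle_trans with (1 := Cmod_triangle _ _), Rplus_le_compat.
- replace (c * Rabs w) with (sqrt ((alpha * (w * dx)) ^ 2)).
  + apply sqrt_le_1_alt; simpl fst; simpl snd.
    replace ((alpha * (C - 1)) ^ 2 + (- alpha * S) ^ 2)
      with (alpha ^ 2 * (1 - 2 * C + C ^ 2 + S ^ 2)) by ring.
    rewrite HS, Rpow_mult_distr; apply Rmult_le_compat_l; [apply pow2_ge_0 | lra].
  + rewrite <- Rsqr_pow2, sqrt_Rsqr_abs.
    replace (alpha * (w * dx)) with (c * w) by (unfold alpha; field; lra).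
    rewrite Rabs_mult, (Rabs_pos_eq c); lra.
- replace (kappa0 * w ^ 2) with (beta * (w * dx) ^ 2)
    by (unfold beta; field; lra).
  rewrite <- (sqrt_pow2 (beta * (w * dx) ^ 2))
    by (apply Rmult_le_pos; [lra | apply pow2_ge_0]).
  apply sqrt_le_1_alt; simpl fst; simpl snd.
  replace ((beta * (1 - C) * (1 + C)) ^ 2 + (- beta * (1 - C) * S) ^ 2)
    with (beta ^ 2 * (1 - C) ^ 2 * ((1 + C) ^ 2 + S ^ 2)) by ring.
  rewrite HS, Rpow_mult_distr, Rmult_assoc.
  apply Rmult_le_compat_l; [apply pow2_ge_0 |].
  assert (0 <= (1 - C) ^ 2) by apply pow2_ge_0.
  apply Rle_trans with ((2 * (1 - C)) ^ 2); [nra |].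
  apply pow_incr; lra.
Qed.

(** * Consistency *)

Lemma sin_taylor5 (x : R) : 0 <= x <= PI ->
  x - x ^ 3 / 6 <= sin x <= x - x ^ 3 / 6 + x ^ 5 / 120.
Proof.
intros [H0 H1]; generalize (sin_bound x 0 H0 H1).
unfold sin_approx, sin_term; simpl; lra.
Qed.

Lemma cos_taylor4 (x : R) : - PI / 2 <= x <= PI / 2 ->
  1 - x ^ 2 / 2 <= cos x <= 1 - x ^ 2 / 2 + x ^ 4 / 24.
Proof.
intros [H0 H1]; generalize (cos_bound x 0 H0 H1).
unfold cos_approx, cos_term; simpl; lra.
Qed.

(** The product form holds at [xi = 0] too, which spares later algebra a case distinction. *)
Lemma sinc_half_spec (xi : R) : xi / 2 * sinc_half xi = sin (xi / 2).
Proof.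
unfold sinc_half; destruct (Req_EM_T xi 0) as [-> | H].
- rewrite !(Rdiv_0_l 2), sin_0; ring.
- field; auto.
Qed.

(** The Taylor bounds of the sine divided by its argument; evenness of the quotient reduces negative
    arguments to positive ones. *)
Lemma sinc_half_taylor (xi : R) : - PI <= xi <= PI ->
  0 <= sinc_half xi - (1 - (xi / 2) ^ 2 / 6) <= (xi / 2) ^ 4 / 120.
Proof.
intros Hxi; set (x := xi / 2).
assert (P : forall y, 0 < y <= PI -> forall s, y * s = sin y ->
  0 <= s - (1 - y ^ 2 / 6) <= y ^ 4 / 120).
{ intros y Hy s Hs; assert (Hb := sin_taylor5 y ltac:(lra)).
  rewrite <- Hs in Hb.
  split; apply Rmult_le_reg_l with y; try lra. }
destruct (Rtotal_order x 0) as [H | [H | H]].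
- replace (x ^ 2) with ((- x) ^ 2) by ring; replace (x ^ 4) with ((- x) ^ 4) by ring.
  apply P; [unfold x in *; lra |].
  rewrite sin_neg; unfold x; rewrite <- sinc_half_spec; ring.
- assert (E : xi = 0) by (unfold x in H; lra).
  rewrite H; unfold sinc_half; destruct (Req_EM_T xi 0); [lra | tauto].
- apply P; [unfold x in *; lra |]; unfold x; apply sinc_half_spec.
Qed.

(** These are the combinations out of which the residuals are built. In the third and fourth the
    terms of order 0 and 2 in [th] cancel, leaving [O(th ^ 4)]. *)
Lemma half_angle_bounds (xi : R) : - PI <= xi <= PI ->
  let th := xi / 2 in
  let s := sinc_half xi in
  let k := cos th in
  th ^ 2 <= 4 /\ 0 <= s <= 1 /\
  Rabs (2 * s ^ 2 - 1 - s * k) <= th ^ 4 /\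
  0 <= k * s - 1 + 2 / 3 * th ^ 2 <= th ^ 4 / 6 /\
  0 <= th ^ 2 * (1 - s ^ 2) <= th ^ 4 / 3.
Proof.
intros Hxi th s k.
assert (Hs : 0 <= s - (1 - th ^ 2 / 6) <= th ^ 4 / 120) by now apply sinc_half_taylor.
assert (Hk : 1 - th ^ 2 / 2 <= k <= 1 - th ^ 2 / 2 + th ^ 4 / 24)
  by (apply cos_taylor4; unfold th; lra).
assert (Hth : th ^ 2 <= 4) by (generalize PI_4; unfold th; nra).
assert (Hth0 : 0 <= th ^ 2) by apply pow2_ge_0.
replace (th ^ 4) with (th ^ 2 * th ^ 2) in * by ring.
set (q := th ^ 2) in *.
(* [a] and [b] are the Taylor remainders of [s] and [k]. The combinations are expressed below
   through products such as [s * a], [s * b], [q * a], each already bounded by a multiple of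
   [q * q]. *)
set (a := s - (1 - q / 6)) in *; set (b := k - (1 - q / 2)).
assert (Ha : 0 <= a <= q * q / 120) by lra.
assert (Hb : 0 <= b <= q * q / 24) by (unfold b; lra).
assert (Es : s = 1 - q / 6 + a) by (unfold a; ring).
assert (Ek : k = 1 - q / 2 + b) by (unfold b; ring).
assert (H01 : 0 <= s <= 1) by nra.
assert (Hsb : 0 <= s * b <= q * q / 24) by nra.
assert (Hsa : 0 <= s * a <= q * q / 120) by nra.
assert (H1s : 0 <= 1 - s <= q / 6) by lra.
assert (Hq1s : 0 <= q * (1 - s) <= q * q / 6) by nra.
assert (Hqa : 0 <= q * a <= q * q / 30) by nra.
assert (Hqq : 0 <= q * q) by nra.
repeat split; try lra.
- apply Rabs_le.
  replace (2 * s ^ 2 - 1 - s * k) with (- (q * q) / 36 + a + q * a / 6 + 2 * (s * a) - s * b)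
    by (rewrite Ek, Es; field); lra.
- replace (k * s - 1 + 2 / 3 * q) with (a + s * b + q * (1 - s) / 2)
    by (rewrite Ek, Es; field); lra.
- replace (k * s - 1 + 2 / 3 * q) with (a + s * b + q * (1 - s) / 2)
    by (rewrite Ek, Es; field); lra.
- nra.
- replace (q * (1 - s ^ 2)) with (q * (1 - s) * (1 + s)) by ring; nra.
Qed.

(** In the half angle [th], all symbols are polynomials in [th], [sr] and [k]. The advective part of
    the first residual vanishes: the flux difference of exact interface values is the exact rate of
    the cell average. Diffusion leaves [beta * th ^ 6], of order [dx ^ 4]. In the second residual
    [beta * th ^ 4] remains, only of order [dx ^ 2]. *)
Lemma consistency (c kappa0 dx w : R) :
  0 < c -> 0 < kappa0 -> 0 < dx -> - PI <= w * dx <= PI ->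
  let g := coeff_mat (RtoC 0) (fourier_matrix c kappa0 dx (w * dx)) in
  let l := lambda c kappa0 w in
  let s := RtoC (sinc_half (w * dx)) in
  let e := wave (w * dx) (/ 2) in
  Cmod ((l - g 0%nat 0%nat) * s - g 0%nat 1%nat * e)%C
    <= kappa0 * w ^ 6 / 16 * dx ^ 4 /\
  Cmod ((l - g 1%nat 1%nat) * e - g 1%nat 0%nat * s)%C
    <= (3 * kappa0 * w ^ 4 + 5 * c * w ^ 4 * dx) / 16 * dx ^ 2.
Proof.
intros Hc Hk Hdx Hxi g l s e.
destruct (fourier_matrix_entries c kappa0 dx (w * dx)) as (G00 & G01 & G10 & G11).
destruct (half_angle_bounds (w * dx) Hxi) as (Hth & Hs & HE & HF & HW).
assert (Hsin := sinc_half_spec (w * dx)).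
fold g in G00, G01, G10, G11.
set (alpha := c / dx) in *; set (beta := kappa0 / dx ^ 2) in *.
assert (Ha : 0 < alpha) by now apply Rdiv_lt_0_compat.
assert (Hb : 0 < beta) by (apply Rdiv_lt_0_compat; auto; now apply pow_lt).
unfold s; set (sr := sinc_half (w * dx)) in *.
set (th := w * dx / 2) in *; set (k := cos th) in *.
assert (Exi : w * dx = 2 * th) by (unfold th; field).
assert (Ee : e = (k, th * sr)).
{ unfold e; rewrite waveE; replace (w * dx * / 2) with th by reflexivity.
  rewrite Hsin; reflexivity. }
assert (Hk2 : k ^ 2 = 1 - (th * sr) ^ 2).
{ rewrite Hsin; generalize (sin2_cos2 th); unfold Rsqr, k; lra. }
assert (EC : cos (w * dx) = 1 - 2 * (th * sr) ^ 2)
  by (rewrite Exi, cos_2a_sin, Hsin; ring).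
assert (ES : sin (w * dx) = 2 * (th * sr) * k)
  by (rewrite Exi, sin_2a, Hsin; reflexivity).
assert (El : l = (- 4 * beta * th ^ 2, - 2 * alpha * th)).
{ unfold l, lambda, th, alpha, beta; apply injective_projections; simpl; field; lra. }
rewrite EC, ES in *.
set (u := th * sr) in *.
split.
- replace (_ - _)%C with (RtoC (4 * beta * th ^ 2 * sr * (2 * sr ^ 2 - 1 - sr * k))).
  + rewrite Cmod_R, !Rabs_mult.
    rewrite (Rabs_pos_eq 4), (Rabs_pos_eq beta), (Rabs_pos_eq sr), (Rabs_pos_eq (th ^ 2))
      by (try apply pow2_ge_0; lra).
    replace (kappa0 * w ^ 6 / 16 * dx ^ 4) with (4 * beta * th ^ 2 * (1 * th ^ 4))
      by (unfold beta, th; field; lra).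
    rewrite Rmult_assoc; apply Rmult_le_compat_l.
    * apply Rmult_le_pos; [lra | apply pow2_ge_0].
    * apply Rmult_le_compat; try lra; apply Rabs_pos.
  + rewrite G00, G01, Ee, El; apply injective_projections; simpl fst; simpl snd.
    * unfold u; ring.
    (* The imaginary part vanishes only modulo [k ^ 2 + u ^ 2 = 1]; the explicit multiple of this
       relation leaves a ring identity. *)
    * transitivity ((2 * alpha * u + 4 * beta * u ^ 3) * (k ^ 2 - (1 - u ^ 2))).
      -- rewrite Hk2; ring.
      -- unfold u; ring.
(* Once the unimodular factor [e] is taken out, [beta * A] is the diffusive residual and
   [alpha * (B, D)] the advective one. *)
- set (A := - 4 * th ^ 2 + 16 - 20 / 3 * u ^ 2 - 16 * k * sr).
  set (B := - 2 * k * sr + 2 - 4 / 3 * u ^ 2).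
  set (D := 2 * th * (2 * sr ^ 2 - 1 - sr * k)).
  replace (_ - _)%C with (Cmult e (Cplus (beta * A) (Cmult alpha (B, D)))).
  + assert (Cmod e = 1) as He.
    { rewrite Ee; unfold Cmod; simpl fst; simpl snd; rewrite Hk2.
      replace (_ + _) with 1 by ring; apply sqrt_1. }
    rewrite Cmod_mult, He, Rmult_1_l.
    apply Rle_trans with (1 := Cmod_triangle _ _).
    rewrite <- RtoC_mult, Cmod_R, Cmod_mult, Cmod_R, Rabs_mult.
    rewrite (Rabs_pos_eq beta), (Rabs_pos_eq alpha) by lra.
    assert (HA : Rabs A <= 3 * th ^ 4).
    { replace A with (- 16 * (k * sr - 1 + 2 / 3 * th ^ 2) + 20 / 3 * (th ^ 2 * (1 - sr ^ 2)))
        by (unfold A, u; field).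
      apply Rabs_le; lra. }
    assert (HBD : Cmod (B, D) <= 5 * th ^ 4).
    { replace (B, D) with (Cplus (RtoC B) (0, D)) by (unfold Cplus; simpl; f_equal; ring).
      apply Rle_trans with (1 := Cmod_triangle _ _).
      rewrite Cmod_R.
      assert (HB : Rabs B <= th ^ 4).
      { replace B with (- 2 * (k * sr - 1 + 2 / 3 * th ^ 2) + 4 / 3 * (th ^ 2 * (1 - sr ^ 2)))
          by (unfold B, u; field).
        apply Rabs_le; lra. }
      assert (HD : Cmod (0, D) <= 4 * th ^ 4).
      { unfold Cmod; simpl fst; simpl snd.
        replace (0 ^ 2 + D ^ 2) with (Rsqr D) by (unfold Rsqr; ring).
        rewrite sqrt_Rsqr_abs; unfold D; rewrite !Rabs_mult, (Rabs_pos_eq 2) by lra.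
        apply Rmult_le_compat; try apply Rabs_pos; auto.
        - apply Rmult_le_pos; [lra | apply Rabs_pos].
        - assert (Rabs th <= 2); [| lra].
          apply Rabs_le; split; nra. }
      lra. }
    replace ((3 * kappa0 * w ^ 4 + 5 * c * w ^ 4 * dx) / 16 * dx ^ 2)
      with (beta * (3 * th ^ 4) + alpha * (5 * th ^ 4))
      by (unfold alpha, beta, th; field; lra).
    apply Rplus_le_compat; apply Rmult_le_compat_l; auto; lra.
  + rewrite G10, G11, Ee, El; apply injective_projections; simpl fst; simpl snd.
    * match goal with |- ?L = ?R => transitivity
        (R + (- 16 * beta * sr - 2 * alpha * sr) * (k ^ 2 - (1 - u ^ 2))) end.
      -- unfold A, B, D, u; field.
      -- rewrite Hk2; ring.
    * unfold A, B, D, u; field.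
Qed.

(** * Convergence *)

(** The phase [wave w (center dx j)] has modulus 1 and drops out, so the bound is the same in every
    cell; the Euclidean norm is at most the sum of the moduli. *)
Lemma norm2_error (c kappa0 w dx : R) (u0 : C) (uhat : R -> CC) (j : Z) (t : R) :
  let l := lambda c kappa0 w in
  let v0 := uhat_init u0 (w * dx) in
  norm2 (minus (exact_vec c kappa0 w dx u0 j t) (numerical_vec w dx uhat j t))
  <= Cmod (Cexp (l * t) * fst v0 - fst (uhat t))%C
     + Cmod (Cexp (l * t) * snd v0 - snd (uhat t))%C.
Proof.
intros l v0; unfold exact_vec, numerical_vec; fold l; fold v0.
rewrite Cexp_add; change (Cexp (Ci * (w * center dx j)%R)) with (wave w (center dx j)).
set (z := wave w (center dx j)).
assert (Hz : Cmod z = 1).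
{ unfold z; rewrite waveE; unfold Cmod; simpl fst; simpl snd.
  generalize (sin2_cos2 (w * center dx j)); unfold Rsqr; intros H.
  replace (_ + _) with 1 by lra; apply sqrt_1. }
set (E := Cexp (l * t)); clearbody E z v0.
set (x := (E * fst v0 - fst (uhat t))%C); set (y := (E * snd v0 - snd (uhat t))%C).
unfold norm2.
match goal with |- sqrt (Cmod (fst ?m) ^ 2 + _) <= _ =>
  replace (fst m) with (z * x)%C; [replace (snd m) with (z * y)%C |] end.
2, 3: unfold x, y, cscal; apply injective_projections; simpl; unfold minus, plus, opp;
  simpl; ring.
rewrite !Cmod_mult, Hz, !Rmult_1_l.
generalize (Cmod_ge_0 x) (Cmod_ge_0 y); intros Hx Hy.
rewrite <- (sqrt_pow2 (Cmod x + Cmod y)) by lra.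
apply sqrt_le_1_alt; nra.
Qed.

Lemma mesh_size_bounds (N : nat) : (0 < N)%nat -> 0 < mesh_size N <= 2 * PI.
Proof.
intros HN; assert (H1 : 1 <= INR N) by (change 1 with (INR 1); apply le_INR; lia).
assert (HPI := PI_RGT_0); unfold mesh_size; split.
- apply Rdiv_lt_0_compat; lra.
- apply Rmult_le_reg_r with (INR N); [lra |].
  unfold Rdiv; rewrite Rmult_assoc, Rinv_l; nra.
Qed.

Theorem proposition3p3 (c kappa0 : R) (omega : Z) (u0 : C) :
  0 < c -> 0 < kappa0 ->
  exists C1 C2 : R, 0 < C1 /\ 0 < C2 /\
    forall N : nat, (0 < N)%nat ->
    let dx := mesh_size N in
    let w := IZR omega in
    let xi := w * dx in
    - PI <= xi <= PI ->
    forall uhat : R -> CC,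
    solves_ivp (fourier_matrix c kappa0 dx xi) (uhat_init u0 xi) uhat ->
    forall (j : Z) (t : R), (0 <= j < Z.of_nat N)%Z -> 0 < t ->
      norm2 (minus (exact_vec c kappa0 w dx u0 j t) (numerical_vec w dx uhat j t))
      <= C1 * t * dx ^ 4 + C2 * dx ^ 4.
Proof.
intros Hc Hk.
(* [H] bounds [dx] and absorbs surplus powers of it. [R1] and [R2] bound the residuals over [dx ^ 4]
   and [dx ^ 2], [P] bounds [p], [B] the entry [G12], and [Y] the quantity [e2 - p e1] over
   [dx ^ 4]. *)
set (w0 := IZR omega); set (H := 2 * PI).
set (R1 := Cmod u0 * (kappa0 * w0 ^ 6 / 16)).
set (R2 := Cmod u0 * ((3 * kappa0 * w0 ^ 4 + 5 * c * w0 ^ 4 * H) / 16)).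
set (P := 24 + 6 * c / kappa0 * H).
set (B := c * Rabs w0 + kappa0 * w0 ^ 2).
set (Y := (R2 + P * (R1 * H ^ 2)) / (8 * kappa0)).
assert (HH : 0 < H) by (unfold H; generalize PI_RGT_0; lra).
assert (Hw2 : 0 <= w0 ^ 2) by apply pow2_ge_0.
assert (Hw4 : 0 <= w0 ^ 4) by (replace (w0 ^ 4) with ((w0 ^ 2) ^ 2) by ring; apply pow2_ge_0).
assert (Hw6 : 0 <= w0 ^ 6) by (replace (w0 ^ 6) with ((w0 ^ 3) ^ 2) by ring; apply pow2_ge_0).
assert (HR1 : 0 <= R1).
{ apply Rmult_le_pos; [apply Cmod_ge_0 |].
  apply Rdiv_le_0_compat; [apply Rmult_le_pos |]; lra. }
assert (HR2 : 0 <= R2).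
{ apply Rmult_le_pos; [apply Cmod_ge_0 |].
  apply Rdiv_le_0_compat; [| lra].
  assert (0 <= kappa0 * w0 ^ 4) by (apply Rmult_le_pos; lra).
  assert (0 <= c * w0 ^ 4 * H) by (apply Rmult_le_pos; [apply Rmult_le_pos |]; lra).
  lra. }
assert (HP : 0 <= P).
{ apply Rplus_le_le_0_compat; [lra |].
  apply Rmult_le_pos; [apply Rdiv_le_0_compat |]; lra. }
assert (HB : 0 <= B).
{ apply Rplus_le_le_0_compat; apply Rmult_le_pos; try lra; apply Rabs_pos. }
assert (HY : 0 <= Y).
{ apply Rdiv_le_0_compat; [| lra].
  apply Rplus_le_le_0_compat; auto.
  apply Rmult_le_pos; [| apply Rmult_le_pos]; auto; apply pow2_ge_0. }
(* From [|e1| + |e2| <= (1 + P) |e1| + |e2 - p e1|]; the added 1 keeps both constants positive even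
   when [u0 = 0]. *)
exists ((1 + P) * (B * Y + R1) + 1), (Y + 1).
assert (HBY : 0 <= B * Y + R1) by (apply Rplus_le_le_0_compat; auto; now apply Rmult_le_pos).
split; [nra | split; [lra |]].
intros N HN dx w xi Hxi uhat Hu j t _ Ht.
destruct (mesh_size_bounds N HN) as [Hdx HdxH]; fold dx H in Hdx, HdxH.
destruct (fourier_matrix_invariant_line c kappa0 dx xi Hc Hk Hdx)
  as (l1 & l2 & p & E1 & E2 & E3 & Hl1 & Hl2 & Hp).
assert (Hb : 0 < kappa0 / dx ^ 2) by (apply Rdiv_lt_0_compat; auto; now apply pow_lt).
assert (Hl : Re (lambda c kappa0 w) <= 0).
{ unfold lambda, Re; simpl; fold w in Hw2; simpl in Hw2; nra. }
destruct (ivp_error_bound _ _ uhat (lambda c kappa0 w) l1 l2 p (8 * (kappa0 / dx ^ 2)) t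
   Hu Ht ltac:(lra) Hl Hl1 Hl2 E1 E2 E3) as [By Bx].
destruct (consistency c kappa0 dx w Hc Hk Hdx Hxi) as [K1 K2].
assert (B01 := fourier_matrix_01_bound c kappa0 dx w Hc Hk Hdx).
fold xi in K1, K2, B01; fold B in B01.
apply Rle_trans with (1 := norm2_error c kappa0 w dx u0 uhat j t); fold xi.
set (g := coeff_mat (RtoC 0) (fourier_matrix c kappa0 dx xi)) in *.
set (l := lambda c kappa0 w) in *; set (v0 := uhat_init u0 xi) in *.
set (e1 := (Cexp (l * t) * fst v0 - fst (uhat t))%C) in *.
set (e2 := (Cexp (l * t) * snd v0 - snd (uhat t))%C) in *.
set (r1 := ((l - g 0%nat 0%nat) * fst v0 - g 0%nat 1%nat * snd v0)%C) in *.
set (r2 := ((l - g 1%nat 1%nat) * snd v0 - g 1%nat 0%nat * fst v0)%C) in *.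
assert (Er1 : Cmod r1 <= R1 * dx ^ 4).
{ unfold R1; rewrite Rmult_assoc.
  match type of K1 with Cmod ?z <= _ => replace r1 with (u0 * z)%C end.
  - rewrite Cmod_mult; apply Rmult_le_compat_l; [apply Cmod_ge_0 | exact K1].
  - unfold r1, v0, uhat_init; simpl fst; simpl snd; ring. }
assert (Er2 : Cmod r2 <= R2 * dx ^ 2).
{ unfold R2; rewrite Rmult_assoc.
  match type of K2 with Cmod ?z <= _ => replace r2 with (u0 * z)%C end.
  - rewrite Cmod_mult; apply Rmult_le_compat_l; [apply Cmod_ge_0 |].
    apply Rle_trans with (1 := K2), Rmult_le_compat_r; [apply pow2_ge_0 |].
    apply Rmult_le_compat_r; [lra |]; apply Rplus_le_compat_l.
    apply Rmult_le_compat_l; auto.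
    apply Rmult_le_pos; lra || exact Hw4.
  - unfold r2, v0, uhat_init; simpl fst; simpl snd; ring. }
assert (HpP : Cmod p <= P).
{ apply Rmult_le_reg_r with (2 / 3 * (kappa0 / dx ^ 2)); [lra |].
  apply Rle_trans with (1 := Hp).
  (* The ratio [alpha / beta] equals [c * dx / kappa0], so [p] stays bounded as [dx] tends to 0. *)
  replace (4 * (c / dx) + 16 * (kappa0 / dx ^ 2))
    with ((24 + 6 * c / kappa0 * dx) * (2 / 3 * (kappa0 / dx ^ 2))) by (field; lra).
  apply Rmult_le_compat_r; [lra |]; apply Rplus_le_compat_l, Rmult_le_compat_l; auto.
  apply Rdiv_le_0_compat; lra. }
assert (Hdx4 : 0 < dx ^ 4) by now apply pow_lt.
assert (Hdx2 : 0 < dx ^ 2) by now apply pow_lt.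
assert (BY : Cmod (r2 - p * r1) / (8 * (kappa0 / dx ^ 2)) <= Y * dx ^ 4).
(* Dividing by the damping rate [8 * kappa0 / dx ^ 2] gains the two orders missing in [r2]. *)
{ replace (Y * dx ^ 4) with ((R2 + P * (R1 * H ^ 2)) * dx ^ 2 / (8 * (kappa0 / dx ^ 2)))
    by (unfold Y; field; lra).
  apply Rmult_le_compat_r; [apply Rlt_le, Rinv_0_lt_compat; lra |].
  unfold Cminus; apply Rle_trans with (1 := Cmod_triangle _ _).
  rewrite Cmod_opp, Cmod_mult, Rmult_plus_distr_r.
  apply Rplus_le_compat; auto; rewrite Rmult_assoc.
  apply Rmult_le_compat; auto; try apply Cmod_ge_0.
  apply Rle_trans with (1 := Er1).
  (* Order [dx ^ 2] is enough for [r1] here, so its other factor [dx ^ 2] is bounded by [H ^ 2]. *)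
  replace (dx ^ 4) with (dx ^ 2 * dx ^ 2) by ring; rewrite Rmult_assoc.
  apply Rmult_le_compat_l; auto; apply Rmult_le_compat_r; [lra |].
  apply pow_incr; lra. }
assert (Bx' : Cmod e1 <= (B * Y + R1) * t * dx ^ 4).
{ apply Rle_trans with (1 := Bx).
  replace ((B * Y + R1) * t * dx ^ 4) with ((B * (Y * dx ^ 4) + R1 * dx ^ 4) * t) by ring.
  apply Rmult_le_compat_r; [lra |]; apply Rplus_le_compat; auto.
  apply Rmult_le_compat; auto; [apply Cmod_ge_0 |].
  apply Rdiv_le_0_compat; [apply Cmod_ge_0 | lra]. }
assert (Be2 : Cmod e2 <= Y * dx ^ 4 + P * Cmod e1).
{ replace e2 with ((e2 - p * e1) + p * e1)%C by ring.
  apply Rle_trans with (1 := Cmod_triangle _ _), Rplus_le_compat; [lra |].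
  rewrite Cmod_mult; apply Rmult_le_compat_r; [apply Cmod_ge_0 | auto]. }
apply Rle_trans with ((1 + P) * ((B * Y + R1) * t * dx ^ 4) + Y * dx ^ 4); [nra |].
assert (0 < t * dx ^ 4) by now apply Rmult_lt_0_compat.
nra.
Qed.
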